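(* Let $\gamma\in(0,1)$ and assume that the material coefficients satisfy $$\gamma_1>0,\quad\alpha_4\ge0,\quad\alpha_1+\frac{\gamma_2^2}{\gamma_1}\ge0,\quad\alpha_5+\alpha_6-\frac{\gamma_2^2}{\gamma_1}\ge0 .$$ Assume that the director field is approximated in the tensor-product LGL nodal basis associated with the same tensor-product LGL quadrature points $\mathbb G_N$ that define $(\cdot,\cdot)_N$, that $\boldsymbol g_2$ is independent of time, and that $$|\boldsymbol n^0(\boldsymbol x)|=1\ \ \forall\,\boldsymbol x\in\mathbb G_N,\qquad|\mathbf I_N\boldsymbol g_2(\boldsymbol x)|=1\ \ \forall\,\boldsymbol x\in\mathbb G_N^{\partial}.$$ Let $(\boldsymbol v^m,\boldsymbol n^m)_{m\ge0}$, $(\boldsymbol\mu_0^{m+\frac12})_{m\ge0}$ be a solution of the fully discrete scheme defined in the context, with arbitrary time steps $\tau_m>0$. Then the scheme preserves the unit length at the LGL nodes: $$|\boldsymbol n^m(\boldsymbol x)|=1\qquad\forall\,\boldsymbol x\in\mathbb G_N,\ m\ge0 .$$ Assume further that the velocity satisfies a homogeneous Dirichlet boundary condition, i.e. $\boldsymbol g_1=\boldsymbol 0$. Then the discrete energy law $$\frac{\mathrm{Re}}{2(1-\gamma)}\|\boldsymbol v^{m+1}\|_N^2+\mathcal F_N[\boldsymbol n^{m+1}]\le\frac{\mathrm{Re}}{2(1-\gamma)}\|\boldsymbol v^m\|_N^2+\mathcal F_N[\boldsymbol n^m]$$ also holds for all $m\ge0$.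
   Context: Notation (summation over repeated indices $1,2,3$): $\mathbf p:\mathbf q=p_{ij}q_{ij}$, $(\mathbf p\cdot\boldsymbol n)_i=p_{ij}n_j$, $(\boldsymbol m\otimes\boldsymbol n)_{ij}=m_in_j$, $(\nabla\boldsymbol v)_{ij}=\partial_iv_j$, $(\boldsymbol v\cdot\nabla\boldsymbol n)_j=v_i\partial_in_j$, $(\nabla\boldsymbol n\cdot\boldsymbol a)_i=(\partial_in_j)a_j$. Constants: $\mathrm{Re}>0$, $\gamma$, $\kappa_1,\kappa_2,\kappa_3$, Leslie coefficients $\alpha_1,\dots,\alpha_6$ with $\alpha_2+\alpha_3=\alpha_6-\alpha_5$, $\gamma_1=\alpha_3-\alpha_2$, $\gamma_2=\alpha_6-\alpha_5$. Domain and quadrature. $\Omega=[a_1,b_1]\times[a_2,b_2]\times[a_3,b_3]$; $\{\hat x_j\}_{j=0}^N$, $\{\hat w_j\}_{j=0}^N$ are the Legendre--Gauss--Lobatto (LGL) nodes and weights on $(-1,1)$; $x_{i;j}=\frac{(b_i-a_i)\hat x_j+a_i+b_i}2$, $w_{i;j}=\frac{b_i-a_i}2\hat w_j$. $\mathbb G_N=\{(x_{1;j_1},x_{2;j_2},x_{3;j_3}):0\le j_1,j_2,j_3\le N\}$, $\mathbb G_N^\partial=\mathbb G_N\cap\partial\Omega$. Discrete inner product $$(u,v)_N=\sum_{j_1,j_2,j_3=0}^Nw_{1;j_1}w_{2;j_2}w_{3;j_3}\,(u\cdot v)(x_{1;j_1},x_{2;j_2},x_{3;j_3}),$$ with $u\cdot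 v$ replaced by the product for scalars and by $u:v$ for matrices; $\|u\|_N=\sqrt{(u,u)_N}$. Spaces. $X_N(\Omega)$: polynomials on $\Omega$ of degree $\le N$ in each variable; $X_{N,0}=X_N\cap H_0^1(\Omega)$; $\mathbb D_N=[X_N]^3$, $\mathbb D_{N,0}=[X_{N,0}]^3$; $\mathbf I_N$ is componentwise interpolation at the LGL nodes (boundary data being identified with a fixed extension to $\Omega$); $\mathbb D_{N,\boldsymbol g}=\mathbf I_N\boldsymbol g+\mathbb D_{N,0}$. The nodal basis is $L_{j_1j_2j_3}=\ell_{j_1}(x_1)\ell_{j_2}(x_2)\ell_{j_3}(x_3)$ with $\ell_j$ the one-dimensional Lagrange basis at the LGL nodes in the respective coordinate. Divergence-free space. $J_n^{(\alpha,\beta)}$ denotes Jacobi polynomials; set $\psi_n(x)=\frac{\sqrt{2(2n-1)}}{n-1}\frac{x^2-1}4J_{n-2}^{(1,1)}(x)$ for $n\ge2$, and $\varphi_n(x)=\frac{\sqrt{8(2n-3)}}{(n-3)(n-2)}\big(\frac{x^2-1}4\big)^2J_{n-4}^{(2,2)}(x)$ for $n\ge4$. On $(-1,1)^3$, $\mathbb V_{N,0}$ is the span, for $m,n,l\in\{1,\dots,N-3\}$, of $$\begin{aligned} &(\varphi_{m+3}(x_1)\psi_{n+2}(x_2)\psi_{l+2}(x_3),-\psi_{m+2}(x_1)\varphi_{n+3}(x_2)\psi_{l+2}(x_3),0),\\ &(\varphi_{m+3}(x_1)\psi_{n+2}(x_2)\psi_{l+2}(x_3),0,-\psi_{m+2}(x_1)\psi_{n+2}(x_2)\varphi_{l+3}(x_3)),\\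 &(0,\psi_2(x_1)\varphi_{n+3}(x_2)\psi_{l+2}(x_3),-\psi_2(x_1)\psi_{n+2}(x_2)\varphi_{l+3}(x_3)),\\ &(\varphi_{m+3}(x_1)\psi_2(x_2)\psi_{l+2}(x_3),0,-\psi_{m+2}(x_1)\psi_2(x_2)\varphi_{l+3}(x_3)),\\ &(\varphi_{m+3}(x_1)\psi_{n+2}(x_2)\psi_2(x_3),-\psi_{m+2}(x_1)\varphi_{n+3}(x_2)\psi_2(x_3),0); \end{aligned}$$ on $\Omega$ it is the image of this span under the contravariant Piola transform of the affine map $(-1,1)^3\to\Omega$. It is contained in $\{\boldsymbol u\in H_0^1(\Omega)^3:\nabla\cdot\boldsymbol u=0\}$. $\mathbb V_{N,\boldsymbol g}=\mathbf I_N\boldsymbol g+\mathbb V_{N,0}$. Time-level notation. $\chi^{m+\frac12}=\frac12(\chi^{m+1}+\chi^m)$; $\beta^k=\boldsymbol n^k\cdot\nabla\times\boldsymbol n^k$, $\boldsymbol\omega^k=\boldsymbol n^k\times(\nabla\times\boldsymbol n^k)$; $\boldsymbol\tau^{m+\frac12}$, $\boldsymbol\Omega^{m+\frac12}$ are the symmetric part $\frac12(\nabla\boldsymbol v+(\nabla\boldsymbol v)^\top)$ and antisymmetric part $\frac12(\nabla\boldsymbol v-(\nabla\boldsymbol v)^\top)$ for $\boldsymbol v=\boldsymbol v^{m+\frac12}$. Trilinear form $b_N(\boldsymbol u,\boldsymbol v,\boldsymbol w)=\frac12\big((\boldsymbol u\cdot\nabla\boldsymbol v,\boldsymbol w)_N-(\boldsymbol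 u\cdot\nabla\boldsymbol w,\boldsymbol v)_N\big)$. Discrete energy $$\mathcal F_N[\boldsymbol n]=\tfrac12\big(\kappa_1\|\nabla\cdot\boldsymbol n\|_N^2+\kappa_2\|\boldsymbol n\cdot\nabla\times\boldsymbol n\|_N^2+\kappa_3\|\boldsymbol n\times\nabla\times\boldsymbol n\|_N^2\big).$$ Fully discrete scheme. For each $m\ge0$, given $(\boldsymbol v^m,\boldsymbol n^m)\in\mathbb V_{N,\boldsymbol g_1}\times\mathbb D_{N,\boldsymbol g_2}$, find $(\boldsymbol v^{m+1},\boldsymbol n^{m+1},\boldsymbol\mu_0^{m+\frac12})\in\mathbb V_{N,\boldsymbol g_1}\times\mathbb D_{N,\boldsymbol g_2}\times\mathbb D_{N,0}$ such that for all $\boldsymbol\phi\in\mathbb V_{N,0}$ and $\boldsymbol\psi,\boldsymbol\theta\in\mathbb D_{N,0}$, with $\boldsymbol q^{m+\frac12}=(\boldsymbol n^{m+\frac12}\times\boldsymbol\mu_0^{m+\frac12})\times\boldsymbol n^{m+\frac12}$, $$\begin{aligned} \tfrac1{\tau_m}(\boldsymbol v^{m+1}-\boldsymbol v^m,\boldsymbol\phi)_N=&-b_N(\boldsymbol v^{m+\frac12},\boldsymbol v^{m+\frac12},\boldsymbol\phi)-\tfrac{\gamma}{\mathrm{Re}}(\nabla\boldsymbol v^{m+\frac12},\nabla\boldsymbol\phi)_N\\&-\tfrac{1-\gamma}{\mathrm{Re}}(\widehat{\boldsymbol\sigma}_0^{\mathrm L}|^{m+\frac12},\nabla\boldsymbol\phi)_N-\tfrac{1-\gamma}{\mathrm{Re}}(\nabla\boldsymbol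 n^{m+\frac12}\cdot\boldsymbol q^{m+\frac12},\boldsymbol\phi)_N,\\ (\boldsymbol n^{m+1}-\boldsymbol n^m,\boldsymbol\psi)_N=&\tfrac{\tau_m}{\gamma_1}\Big(\big\{\boldsymbol n^{m+\frac12}\times[\boldsymbol\mu_0^{m+\frac12}-\gamma_1(\boldsymbol v^{m+\frac12}\cdot\nabla\boldsymbol n^{m+\frac12}+\boldsymbol\Omega^{m+\frac12}\cdot\boldsymbol n^{m+\frac12})\\&\qquad-\gamma_2\boldsymbol\tau^{m+\frac12}\cdot\boldsymbol n^{m+\frac12}]\big\}\times\boldsymbol n^{m+\frac12},\boldsymbol\psi\Big)_N,\\ (-\boldsymbol\mu_0^{m+\frac12},\boldsymbol\theta)_N=&\ \kappa_1(\nabla\cdot\boldsymbol n^{m+\frac12},\nabla\cdot\boldsymbol\theta)_N+\kappa_2(\beta^{m+\frac12}\nabla\times\boldsymbol n^{m+\frac12},\boldsymbol\theta)_N+\kappa_2(\beta^{m+\frac12}\boldsymbol n^{m+\frac12},\nabla\times\boldsymbol\theta)_N\\&+\kappa_3((\nabla\times\boldsymbol n^{m+\frac12})\times\boldsymbol\omega^{m+\frac12},\boldsymbol\theta)_N+\kappa_3(\boldsymbol\omega^{m+\frac12}\times\boldsymbol n^{m+\frac12},\nabla\times\boldsymbol\theta)_N, \end{aligned}$$ where (right side at level $m+\frac12$) $$\begin{aligned}\widehat{\boldsymbol\sigma}^{\mathrm L}_0|^{m+\frac12}=&\Big(\alpha_1+\frac{\gamma_2^2}{\gamma_1}\Big)(\boldsymbol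 n\otimes\boldsymbol n:\boldsymbol\tau)\,\boldsymbol n\otimes\boldsymbol n+\frac{\alpha_2}{\gamma_1}\boldsymbol n\otimes\boldsymbol q+\frac{\alpha_3}{\gamma_1}\boldsymbol q\otimes\boldsymbol n+\alpha_4\boldsymbol\tau\\&+\Big(\frac{\alpha_5+\alpha_6}2-\frac{\gamma_2^2}{2\gamma_1}\Big)\big(\boldsymbol n\otimes(\boldsymbol\tau\cdot\boldsymbol n)+(\boldsymbol\tau\cdot\boldsymbol n)\otimes\boldsymbol n\big).\end{aligned}$$ *)

(* Defs.v *)
(* [mpoly] has to be imported before [all_analysis]: in the opposite order
   their notations clash. *)
From mathcomp Require Import all_boot all_order all_algebra.
From mathcomp Require Import mpoly.
From mathcomp Require Import all_classical all_reals all_analysis.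

Set Implicit Arguments.
Unset Strict Implicit.
Unset Printing Implicit Defensive.

Import Order.TTheory GRing.Theory Num.Theory.
Local Open Scope classical_set_scope.
Local Open Scope ring_scope.

(* Every field below is a polynomial in x_1, x_2, x_3 (coordinates are indexed
   by 'I_3 = {0, 1, 2}), so fields are members of {mpoly R[3]} and partial
   derivatives are [mderiv].  Products of fields may leave X_N; the discrete
   inner product only evaluates them at the nodes. *)
Notation pt3 R := ('I_3 -> R).
Notation vec R := ('cV[{mpoly R[3]}]_3).
Notation ten R := ('M[{mpoly R[3]}]_3).

Section Calculus.
Context {R : realType}.
Implicit Types (u v w : vec R) (p q : ten R).

Definition vec3 (f0 f1 f2 : {mpoly R[3]}) : vec R :=
  \col_(i < 3) [:: f0; f1; f2]`_i.

(* p : q for tensors, u . v for column vectors *)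
Definition mdot k l (p q : 'M[{mpoly R[3]}]_(k, l)) : {mpoly R[3]} :=
  \sum_i \sum_j p i j * q i j.

Definition tensor u v : ten R := u *m v^T.

(* The indices i + 1 and i + 2 are taken modulo 3. *)
Definition cross u v : vec R :=
  \col_(i < 3) (u (i + 1) 0 * v (i + 2) 0 - u (i + 2) 0 * v (i + 1) 0).

Definition curl v : vec R :=
  \col_(i < 3) ((v (i + 2) 0)^`M(i + 1) - (v (i + 1) 0)^`M(i + 2)).

Definition dvg v : {mpoly R[3]} := \sum_(i < 3) (v i 0)^`M(i).

Definition grad v : ten R := \matrix_(i, j) (v j 0)^`M(i).

Definition convect u v : vec R := \col_j \sum_i u i 0 * grad v i j.

Definition strain v : ten R := (2^-1)%:MP *: (grad v + (grad v)^T).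

Definition vorticity v : ten R := (2^-1)%:MP *: (grad v - (grad v)^T).

Definition veval u (x : pt3 R) : 'cV[R]_3 := map_mx (meval x) u.

End Calculus.

Definition enorm {R : realType} (u : 'cV[R]_3) : R :=
  Num.sqrt (\sum_i u i 0 ^+ 2).

Section OneDimensional.
Context {R : realType}.

(* Obtained by Leibniz' rule from Rodrigues' formula
   (1-x)^al (1+x)^be J_n = (-1)^n / (2^n n!) D^n [(1-x)^(n+al) (1+x)^(n+be)];
   normalised by J_n(1) = binomial(n + al, n). *)
Definition jacobi (al be n : nat) : {poly R} :=
  \sum_(s < n.+1) ('C(n + al, n - s) * 'C(n + be, s))%N%:R *:
    ((2^-1 *: ('X - 1)) ^+ s * (2^-1 *: ('X + 1)) ^+ (n - s)).

Definition legendre (n : nat) : {poly R} := jacobi 0 0 n.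

(* meaningful for 2 <= n *)
Definition psi (n : nat) : {poly R} :=
  (Num.sqrt (2 * (2 * n%:R - 1)) / (n%:R - 1)) *:
    ((4^-1 *: ('X^2 - 1)) * jacobi 1 1 (n - 2)).

(* meaningful for 4 <= n *)
Definition phi (n : nat) : {poly R} :=
  (Num.sqrt (8 * (2 * n%:R - 3)) / ((n%:R - 3) * (n%:R - 2))) *:
    ((4^-1 *: ('X^2 - 1)) ^+ 2 * jacobi 2 2 (n - 4)).

End OneDimensional.

(* The Legendre--Gauss--Lobatto rule with N + 1 points: the end points and the
   zeros of the derivative of the N-th Legendre polynomial, with the weights
   that make the rule exact on polynomials of degree at most 2N - 1. *)
Record lgl_rule (R : realType) (N : nat) := LglRule {
  lgl_node : 'I_N.+1 -> R;
  lgl_weight : 'I_N.+1 -> R;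
  lgl_node_incr : forall j k : 'I_N.+1, (j < k)%N -> lgl_node j < lgl_node k;
  lgl_node_first : lgl_node ord0 = -1;
  lgl_node_last : lgl_node ord_max = 1;
  lgl_node_inner : forall j : 'I_N.+1, (0 < j < N)%N ->
    root (legendre N)^`() (lgl_node j);
  lgl_exact : forall p : {poly R}, (size p <= 2 * N)%N ->
    \sum_j lgl_weight j * p.[lgl_node j] =
    \int[lebesgue_measure]_(t in `[-1, 1]) p.[t]
}.

Record box (R : realType) := Box {
  lo : pt3 R;
  hi : pt3 R;
  lo_lt_hi : forall i, lo i < hi i
}.

Section Discretisation.
Context {R : realType} {N : nat}.
Variables (B : box R) (Q : lgl_rule R N).
Implicit Types (f : {mpoly R[3]}) (u v w : vec R).

Definition domain : set (pt3 R) := [set x | forall i, lo B i <= x i <= hi B i].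

Definition boundary : set (pt3 R) :=
  [set x | domain x /\ exists i, x i = lo B i \/ x i = hi B i].

Definition node1 (i : 'I_3) (j : 'I_N.+1) : R :=
  ((hi B i - lo B i) * lgl_node Q j + lo B i + hi B i) / 2.

Definition weight1 (i : 'I_3) (j : 'I_N.+1) : R :=
  (hi B i - lo B i) / 2 * lgl_weight Q j.

Definition node (j : {ffun 'I_3 -> 'I_N.+1}) : pt3 R :=
  fun i => node1 i (j i).

Definition weight (j : {ffun 'I_3 -> 'I_N.+1}) : R := \prod_i weight1 i (j i).

Definition grid : set (pt3 R) := range node.

Definition bgrid : set (pt3 R) := grid `&` boundary.

Definition quad f : R := \sum_j weight j * f.@[node j].

Definition dip k l (p q : 'M[{mpoly R[3]}]_(k, l)) : R := quad (mdot p q).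

Definition sdip (f g : {mpoly R[3]}) : R := quad (f * g).

Definition dnorm k l (p : 'M[{mpoly R[3]}]_(k, l)) : R := Num.sqrt (dip p p).

Definition sdnorm f : R := Num.sqrt (sdip f f).

Definition lagrange1 (i : 'I_3) (j : 'I_N.+1) : {poly R} :=
  \prod_(k | k != j) ((node1 i j - node1 i k)^-1 *: ('X - (node1 i k)%:P)).

(* the univariate polynomial p taken at the i-th coordinate *)
Definition along (i : 'I_3) (p : {poly R}) : {mpoly R[3]} :=
  (map_poly (@mpolyC 3 R) p).['X_i].

Definition nodal_basis (j : {ffun 'I_3 -> 'I_N.+1}) : {mpoly R[3]} :=
  \prod_i along i (lagrange1 i (j i)).

Definition nodal_comb (c : {ffun 'I_3 -> 'I_N.+1} -> 'cV[R]_3) : vec R :=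
  \col_i \sum_j c j i 0 *: nodal_basis j.

Definition in_nodal_span u : Prop := exists c, u = nodal_comb c.

Definition interp (g : pt3 R -> 'cV[R]_3) : vec R :=
  nodal_comb (fun j => g (node j)).

Definition XN : set {mpoly R[3]} :=
  [set f | forall m, m \in msupp f -> forall i : 'I_3, (m i <= N)%N].

(* For a polynomial the trace on the boundary is the restriction, so membership
   in H^1_0 means vanishing on the boundary. *)
Definition XN0 : set {mpoly R[3]} :=
  [set f | XN f /\ forall x, boundary x -> f.@[x] = 0].

Definition DN0 : set (vec R) := [set u | forall i, XN0 (u i 0)].

Definition DNg (g : pt3 R -> 'cV[R]_3) : set (vec R) :=
  [set interp g + w | w in DN0].

Definition tprod (p q r : {poly R}) : {mpoly R[3]} :=
  along 0 p * along 1 q * along 2 r.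

Definition div_free_basis (k : 'I_5) (m n l : nat) : vec R :=
  [:: vec3 (tprod (phi (m + 3)) (psi (n + 2)) (psi (l + 2)))
           (- tprod (psi (m + 2)) (phi (n + 3)) (psi (l + 2)))
           0;
      vec3 (tprod (phi (m + 3)) (psi (n + 2)) (psi (l + 2)))
           0
           (- tprod (psi (m + 2)) (psi (n + 2)) (phi (l + 3)));
      vec3 0
           (tprod (psi 2) (phi (n + 3)) (psi (l + 2)))
           (- tprod (psi 2) (psi (n + 2)) (phi (l + 3)));
      vec3 (tprod (phi (m + 3)) (psi 2) (psi (l + 2)))
           0
           (- tprod (psi (m + 2)) (psi 2) (phi (l + 3)));
      vec3 (tprod (phi (m + 3)) (psi (n + 2)) (psi 2))
           (- tprod (psi (m + 2)) (phi (n + 3)) (psi 2))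
           0]`_k.

(* indices 1 <= m, n, l <= N - 3; empty when N <= 3 *)
Definition div_free_ref : set (vec R) :=
  [set u | exists c : 'I_5 -> nat -> nat -> nat -> R,
     u = \sum_(k < 5) \sum_(1 <= m < N - 2) \sum_(1 <= n < N - 2)
           \sum_(1 <= l < N - 2) (c k m n l)%:MP *: div_free_basis k m n l].

(* the affine map (-1,1)^3 -> domain is xh |-> affine_jac * xh + (lo + hi) / 2 *)
Definition affine_jac : 'M[R]_3 := diag_mx (\row_i ((hi B i - lo B i) / 2)).

Definition inv_affine : 3.-tuple {mpoly R[3]} :=
  [tuple ((hi B i - lo B i) / 2)^-1 *: ('X_i - ((lo B i + hi B i) / 2)%:MP)
     | i < 3].

(* contravariant: (det F')^-1 F' uh, composed with the inverse map *)
Definition piola u : vec R :=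
  map_mx (@mpolyC 3 R) ((\det affine_jac)^-1 *: affine_jac) *m
  map_mx (comp_mpoly inv_affine) u.

Definition VN0 : set (vec R) := [set piola u | u in div_free_ref].

Definition VNg (g : pt3 R -> 'cV[R]_3) : set (vec R) :=
  [set interp g + w | w in VN0].

Definition triN u v w : R :=
  2^-1 * (dip (convect u v) w - dip (convect u w) v).

End Discretisation.

Arguments DN0 {R} N B.
Arguments VN0 {R} N B.

Record coeffs (R : realType) := Coeffs {
  Rey : R; gam : R;
  kap1 : R; kap2 : R; kap3 : R;
  alp1 : R; alp2 : R; alp3 : R; alp4 : R; alp5 : R; alp6 : R
}.

Section Scheme.
Context {R : realType} {N : nat}.
Variables (B : box R) (Q : lgl_rule R N) (P : coeffs R).
Implicit Types (n q : vec R) (T : ten R).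

Definition gam1 : R := alp3 P - alp2 P.

Definition gam2 : R := alp6 P - alp5 P.

(* beta^k and omega^k as functions of n^k *)
Definition betaF n : {mpoly R[3]} := mdot n (curl n).

Definition omegaF n : vec R := cross n (curl n).

(* sigma_0^L as a function of n, q and of the strain rate T *)
Definition sigmaL n q T : ten R :=
  (alp1 P + gam2 ^+ 2 / gam1)%:MP *: (mdot (tensor n n) T *: tensor n n)
  + (alp2 P / gam1)%:MP *: tensor n q
  + (alp3 P / gam1)%:MP *: tensor q n
  + (alp4 P)%:MP *: T
  + ((alp5 P + alp6 P) / 2 - gam2 ^+ 2 / (2 * gam1))%:MP *:
      (tensor n (T *m n) + tensor (T *m n) n).

Definition energyN n : R :=
  2^-1 * (kap1 P * sdnorm B Q (dvg n) ^+ 2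
        + kap2 P * sdnorm B Q (betaF n) ^+ 2
        + kap3 P * dnorm B Q (omegaF n) ^+ 2).

(* value at level m + 1/2; beta^(m+1/2) and omega^(m+1/2) are averages of
   beta and omega at levels m and m + 1, not beta and omega of n^(m+1/2) *)
Definition mid (chi : nat -> vec R) (m : nat) : vec R :=
  (2^-1)%:MP *: (chi m.+1 + chi m).

Definition smid (chi : nat -> {mpoly R[3]}) (m : nat) : {mpoly R[3]} :=
  2^-1 *: (chi m.+1 + chi m).

Section Equations.
Variables (dt : nat -> R) (v n mu : nat -> vec R) (m : nat).

Let vh := mid v m.
Let nh := mid n m.
Let qh := cross (cross nh (mu m)) nh.
Let betah := smid (betaF \o n) m.
Let omegah := mid (omegaF \o n) m.
Let tauh := strain vh.
Let Omegah := vorticity vh.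

Definition momentum_eq (w : vec R) : Prop :=
  (dt m)^-1 * dip B Q (v m.+1 - v m) w =
  - triN B Q vh vh w
  - gam P / Rey P * dip B Q (grad vh) (grad w)
  - (1 - gam P) / Rey P * dip B Q (sigmaL nh qh tauh) (grad w)
  - (1 - gam P) / Rey P * dip B Q (grad nh *m qh) w.

Definition director_eq (w : vec R) : Prop :=
  dip B Q (n m.+1 - n m) w =
  dt m / gam1 *
  dip B Q
    (cross
       (cross nh
          (mu m - gam1%:MP *: (convect vh nh + Omegah *m nh)
                - gam2%:MP *: (tauh *m nh)))
       nh)
    w.

Definition potential_eq (w : vec R) : Prop :=
  dip B Q (- mu m) w =
    kap1 P * sdip B Q (dvg nh) (dvg w)
  + kap2 P * dip B Q (betah *: curl nh) w
  + kap2 P * dip B Q (betah *: nh) (curl w)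
  + kap3 P * dip B Q (cross (curl nh) omegah) w
  + kap3 P * dip B Q (cross omegah nh) (curl w).

End Equations.

(* [mu m] is mu_0^(m+1/2); the boundary data (extended to the domain) may
   a priori depend on the time level. *)
Record is_solution (g1 g2 : nat -> pt3 R -> 'cV[R]_3) (dt : nat -> R)
    (v n mu : nat -> vec R) : Prop := IsSolution {
  velocity_space : forall m, VNg B Q (g1 m) (v m);
  director_space : forall m, DNg B Q (g2 m) (n m);
  potential_space : forall m, DN0 N B (mu m);
  momentum : forall m w, VN0 N B w -> momentum_eq dt v n mu m w;
  director : forall m w, DN0 N B w -> director_eq dt v n mu m w;
  potential : forall m w, DN0 N B w -> potential_eq n mu m w
}.

End Scheme.

(* Main.v *)
(* At an interior node the director equation can be tested with the nodal basis
   function times the value there of n^(m+1/2).  As the LGL weights are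
   positive, and the right-hand side is a cross product with n^(m+1/2), this
   gives (n^(m+1) - n^m) . (n^(m+1) + n^m) = 0 at the node, while boundary nodes
   carry the unit data.  For the energy law, test the three equations with
   v^(m+1/2), mu and n^(m+1) - n^m: averaging beta and omega, rather than
   evaluating them at n^(m+1/2), makes the last one an exact increment of the
   discrete energy, and the remaining cross terms cancel by
   alpha_2 + alpha_3 = gamma_2. *)
Require Import Defs.
From mathcomp Require Import all_boot all_order all_algebra.
From mathcomp Require Import ring lra zify.
From mathcomp Require Import mpoly.
From mathcomp Require Import all_classical all_reals all_analysis.

Set Implicit Arguments.
Unset Strict Implicit.
Unset Printing Implicit Defensive.

Import Order.TTheory GRing.Theory Num.Theory numFieldNormedType.Exports.
Local Open Scope classical_set_scope.
Local Open Scope ring_scope.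

(** * Positivity of the LGL weights *)

(** Finiteness of the root set is what makes it a Lebesgue null set below. Each root found is split
    off as a linear factor, which lowers the degree. *)
Lemma roots_bounded_by_seq (F : fieldType) (p : {poly F}) :
  p != 0 -> exists s : seq F, forall t, root p t -> t \in s.
Proof.
have [k] := ubnP (size p); elim: k p => // k IHk p lek p0.
have [[a /factor_theorem[q pE]]|no_root] := pselect (exists a, root p a).
  have q0 : q != 0 by apply: contra_neq p0 => q0; rewrite pE q0 mul0r.
  have [|s sP] := IHk q _ q0.
    by move: lek; rewrite pE size_Mmonic ?monicXsubC // size_XsubC addn2.
  exists (a :: s) => t; rewrite pE rootM root_XsubC inE => /orP[/sP ->|-> //].
  by rewrite orbT.
by exists [::] => t pt; case: no_root; exists t.
Qed.

(** A nonnegative function with zero integral vanishes almost everywhere, so a zero integral would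
    put [a, b], up to a null set, inside the finite root set of [p], against its positive length. *)
Lemma Rintegral_poly_gt0 (R : realType) (p : {poly R}) (a b : R) :
  a < b -> p != 0 -> (forall t, a <= t <= b -> 0 <= p.[t]) ->
  0 < \int[lebesgue_measure]_(t in `[a, b]) p.[t].
Proof.
move=> ab p0 pge0.
have cp : {within `[a, b], continuous (horner p)}.
  by apply: continuous_subspaceT => t; exact: continuous_horner.
have ip : lebesgue_measure.-integrable `[a, b] (EFin \o horner p).
  by apply: continuous_compact_integrable => //; exact: segment_compact.
have pge0' t : `[a, b]%classic t -> 0 <= p.[t].
  by rewrite /= in_itv /=; exact: pge0.
rewrite lt_neqAle Rintegral_ge0 // andbT eq_sym; apply/negP => /eqP I0.
have Ie0 : (\int[lebesgue_measure]_(t in `[a, b])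
              `|(EFin \o horner p) t| = 0)%E.
  under eq_integral => t tab.
    rewrite gee0_abs; last by rewrite lee_fin pge0' //; move: tab; rewrite inE.
    over.
  rewrite -[LHS]fineK; first by rewrite [fine _]I0.
  exact: integrable_fin_num.
have [mp _] := integrableP _ _ _ ip.
have negM :=
  (ae_eq_integral_abs lebesgue_measure (measurable_itv _) mp).1 Ie0.
have [s sP] := roots_bounded_by_seq p0.
have negZ : lebesgue_measure.-negligible [set` s].
  exists [set` s]; split => //.
    exact/countable_measurable/finite_set_countable/finite_seq.
  exact/countable_lebesgue_measure0/finite_set_countable/finite_seq.
have : lebesgue_measure.-negligible `[a, b]%classic.
  apply: negligibleS (negligibleU negM negZ) => t tab.
  have [pt|pt] := boolP (root p t); first by right; apply: sP.
  by left => /= /(_ tab) [] /eqP; apply/negP.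
move=> neg; have /eqP : lebesgue_measure `[a, b]%classic = 0%E :> \bar R.
  by apply: measure_negligible neg; exact: measurable_itv.
by rewrite lebesgue_measure_itv /= lte_fin ab -EFinB eqe subr_eq0 gt_eqF.
Qed.

(* Exactness stops at degree 2N - 1, one short of the square of a Lagrange
   polynomial: the factor of an end point other than the j-th node is taken
   linear, since it does not change sign on [-1, 1]. *)
Lemma lgl_weight_gt0 (R : realType) (N : nat) (Q : lgl_rule R N)
  (j : 'I_N.+1) : (0 < N)%N -> 0 < lgl_weight Q j.
Proof.
move=> N0.
have inj k l : k != l -> lgl_node Q k - lgl_node Q l != 0.
  rewrite subr_eq0 -val_eqE neq_ltn => /orP[] /(lgl_node_incr Q) lt.
    by rewrite lt_eqF.
  by rewrite gt_eqF.
have [L [k0 [k0j sL Lj L0 Lge0]]] : exists (L : {poly R}) (k0 : 'I_N.+1),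
    [/\ k0 != j, size L = 2, 0 < L.[lgl_node Q j], L.[lgl_node Q k0] = 0
      & forall t, -1 <= t <= 1 -> 0 <= L.[t]].
  have [->|j0] := eqVneq j ord0.
    exists (- ('X - 1%:P)), ord_max; split.
    - by rewrite -val_eqE /= -lt0n.
    - by rewrite size_polyN size_XsubC.
    - by rewrite !hornerE (lgl_node_first Q); lra.
    - by rewrite !hornerE (lgl_node_last Q); lra.
    - by move=> t; rewrite !hornerE; lra.
  exists ('X - (-1)%:P), ord0; split.
  - by rewrite eq_sym.
  - by rewrite size_XsubC.
  - by rewrite hornerXsubC -(lgl_node_first Q) subr_gt0 lgl_node_incr // lt0n.
  - by rewrite !hornerE (lgl_node_first Q); lra.
  - by move=> t; rewrite !hornerE; lra.
pose M : {poly R} := \prod_(k | (k != j) && (k != k0)) ('X - (lgl_node Q k)%:P).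
have Mj : M.[lgl_node Q j] != 0.
  rewrite horner_prod; apply/prodf_neq0 => k /andP[kj _].
  by rewrite !hornerE inj // eq_sym.
(* [p] vanishes at every node but the j-th ([L] at [k0], [M] at the others), so its quadrature is
   the j-th weight times a positive value, while its integral is positive. *)
pose p := L * M ^+ 2.
have pj : 0 < p.[lgl_node Q j].
  by rewrite hornerM horner_exp mulr_gt0 // exprn_even_gt0 //= Mj orbT.
have p0 : p != 0 by apply: contraTneq pj => ->; rewrite horner0 ltxx.
have sM : size M = N.
  rewrite /M size_prod; last by move=> k _; rewrite polyXsubC_eq0.
  under eq_bigr do rewrite size_XsubC.
  rewrite sum_nat_const.
  have : #|[pred k | (k != j) && (k != k0)]| = N.-1.
    have := cardC (pred2 j k0); rewrite card2 eq_sym k0j card_ord => cardE.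
    have e c : (2 + c)%N = N.+1 -> c = N.-1 by lia.
    apply/e/(etrans _ cardE); congr (_ + _)%N; apply: eq_card => k.
    by rewrite !inE negb_or.
  rewrite /= => ->; lia.
have /(lgl_exact Q) : (size p <= 2 * N)%N.
  rewrite (leq_trans (size_polyMleq _ _)) // sL add2n /=.
  rewrite (leq_ltn_trans (size_poly_exp_leq _ _)) // sM.
  by case: (N) N0 => // N1 _; rewrite mulnC; lia.
rewrite (bigD1 j) //= big1 ?addr0 => [pE|k kj].
  have : 0 < lgl_weight Q j * p.[lgl_node Q j].
    rewrite pE; apply: Rintegral_poly_gt0 => // t tI.
    by rewrite hornerM horner_exp mulr_ge0 ?Lge0 // exprn_even_ge0.
  by rewrite pmulr_lgt0.
have [->|kk0] := eqVneq k k0; first by rewrite hornerM L0 mul0r mulr0.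
have -> : p.[lgl_node Q k] = 0; last by rewrite mulr0.
rewrite hornerM horner_exp (_ : M.[_] = 0) ?expr0n ?mulr0 //.
apply/eqP; rewrite horner_prod; apply/prodf_eq0; exists k; rewrite ?kj //.
by rewrite !hornerE subrr.
Qed.

(** * Pointwise vector and tensor identities *)

Section VectorAlgebra.
Context {R : realType}.
Implicit Types (a b c u v w : vec R) (p q T : ten R).

Lemma sum3E (V : nmodType) (F : 'I_3 -> V) : \sum_i F i = F 0 + F 1 + F 2.
Proof.
rewrite !big_ord_recl big_ord0 addr0 addrA.
by congr (F _ + F _ + F _); apply: val_inj.
Qed.

(** Evaluating the cyclic indices of [cross] leaves polynomial identities in the three components,
    within reach of [ring]. *)
Lemma I3D : ((0 + 1 = 1 :> 'I_3)%R * (0 + 2 = 2 :> 'I_3)%R *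
  (1 + 1 = 2 :> 'I_3)%R * (1 + 2 = 0 :> 'I_3)%R * (2 + 1 = 0 :> 'I_3)%R *
  (2 + 2 = 1 :> 'I_3)%R)%type.
Proof. by do !split; apply: val_inj. Qed.

Lemma mdotE u v : mdot u v = u 0 0 * v 0 0 + u 1 0 * v 1 0 + u 2 0 * v 2 0.
Proof. by rewrite /mdot sum3E !big_ord1. Qed.

Lemma mdotC k l (p q : 'M[{mpoly R[3]}]_(k, l)) : mdot p q = mdot q p.
Proof. by apply: eq_bigr => i _; apply: eq_bigr => j _; rewrite mulrC. Qed.

Lemma mdotDl k l (p q r : 'M[{mpoly R[3]}]_(k, l)) :
  mdot (p + q) r = mdot p r + mdot q r.
Proof.
rewrite -big_split; apply: eq_bigr => i _; rewrite -big_split.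
by apply: eq_bigr => j _; rewrite mxE mulrDl.
Qed.

Lemma mdotZl k l (f : {mpoly R[3]}) (p q : 'M[{mpoly R[3]}]_(k, l)) :
  mdot (f *: p) q = f * mdot p q.
Proof.
rewrite mulr_sumr; apply: eq_bigr => i _; rewrite mulr_sumr.
by apply: eq_bigr => j _; rewrite mxE mulrA.
Qed.

Lemma mdotNl k l (p q : 'M[{mpoly R[3]}]_(k, l)) : mdot (- p) q = - mdot p q.
Proof. by rewrite -scaleN1r mdotZl mulN1r. Qed.

Lemma mdotDr k l (p q r : 'M[{mpoly R[3]}]_(k, l)) :
  mdot r (p + q) = mdot r p + mdot r q.
Proof. by rewrite mdotC mdotDl !(mdotC _ r). Qed.

Lemma mdotZr k l (f : {mpoly R[3]}) (p q : 'M[{mpoly R[3]}]_(k, l)) :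
  mdot p (f *: q) = f * mdot p q.
Proof. by rewrite mdotC mdotZl mdotC. Qed.

Lemma mdotNr k l (p q : 'M[{mpoly R[3]}]_(k, l)) : mdot p (- q) = - mdot p q.
Proof. by rewrite mdotC mdotNl mdotC. Qed.

Lemma mdot_tensor u v T : mdot (tensor u v) T = mdot u (T *m v).
Proof.
by apply: eq_bigr => i _; rewrite big_ord1 !mxE mulr_sumr;
   apply: eq_bigr => j _; rewrite !mxE big_ord1 !mxE mulrA mulrAC.
Qed.

Lemma mdot_mulmx T u v : mdot (T *m u) v = mdot u (T^T *m v).
Proof.
rewrite /mdot; under eq_bigr do rewrite big_ord1 mxE mulr_suml.
rewrite exchange_big /=; apply: eq_bigr => i _.
rewrite big_ord1 mxE mulr_sumr; apply: eq_bigr => j _.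
by rewrite mxE mulrAC mulrC mulrA.
Qed.

(** Cyclicity of the scalar triple product. Used in both directions, it makes a |-> (n x a) x n
    symmetric. *)
Lemma mdot_cross_cross n a b :
  mdot (cross (cross n a) n) b = mdot (cross n a) (cross n b).
Proof. by rewrite !mdotE !mxE !I3D; ring. Qed.

Lemma mdot_cross_id n a : mdot (cross a n) n = 0.
Proof. by rewrite !mdotE !mxE !I3D; ring. Qed.

(** Matches the elastic force of the momentum equation, tested with the velocity, to the convection
    of the director, so that the two cancel in the energy balance. *)
Lemma mdot_convect u v w : mdot (grad v *m w) u = mdot (convect u v) w.
Proof.
rewrite mdot_mulmx mdotC; congr mdot; apply/colP => j; rewrite !mxE.
by apply: eq_bigr => i _; rewrite !mxE mulrC.
Qed.

Lemma mpoly_halfD : (2^-1)%:MP + (2^-1)%:MP = 1 :> {mpoly R[3]}.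
Proof. by rewrite -mpolyCD -[2^-1]mul1r -splitr. Qed.

Lemma gradE v : grad v = strain v + vorticity v.
Proof.
apply/matrixP => i j; rewrite !mxE; set g := _^`M(i); set h := _^`M(j).
by rewrite -[LHS]mul1r -mpoly_halfD; ring.
Qed.

Lemma strain_sym v : (strain v)^T = strain v.
Proof. by rewrite /strain linearZ /= linearD /= trmxK addrC. Qed.

Lemma vorticity_antisym v : (vorticity v)^T = - vorticity v.
Proof. by rewrite /vorticity linearZ /= linearB /= trmxK -scalerN opprB. Qed.

Lemma mpoly_eq_opp0 (f : {mpoly R[3]}) : f = - f -> f = 0.
Proof.
move=> /eqP; rewrite -subr_eq0 opprK -mulr2n -scaler_nat.
by rewrite -mul_mpolyC mulf_eq0 mpolyC_eq0 pnatr_eq0 => /eqP.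
Qed.

Lemma mdot_antisym_mul T u : T^T = - T -> mdot u (T *m u) = 0.
Proof.
move=> TN; apply: mpoly_eq_opp0.
by rewrite {1}mdotC mdot_mulmx TN mulNmx mdotNr.
Qed.

Lemma mdot_sym_antisym p T : p^T = p -> T^T = - T -> mdot p T = 0.
Proof.
move=> pS TN; apply: mpoly_eq_opp0.
rewrite -mdotNr -TN -[in RHS]pS /mdot exchange_big.
by do 2![apply: eq_bigr => ? _]; rewrite !mxE.
Qed.

(** Symmetric tensors only see [T]. The two tensor products of [n] and [q] are transposes of each
    other: they agree on [T] and are opposite on [W], hence the sum and the difference of [c2] and
    [c3]. *)
Lemma mdot_stress (c1 c2 c3 c4 c5 : {mpoly R[3]}) (n q : vec R) (T W : ten R) :
  T^T = T -> W^T = - W ->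
  mdot (c1 *: (mdot (tensor n n) T *: tensor n n) + c2 *: tensor n q
        + c3 *: tensor q n + c4 *: T
        + c5 *: (tensor n (T *m n) + tensor (T *m n) n)) (T + W) =
  c1 * mdot (tensor n n) T ^+ 2 + c4 * mdot T T
  + (c5 + c5) * mdot (T *m n) (T *m n)
  + (c2 + c3) * mdot (T *m n) q + (c3 - c2) * mdot (W *m n) q.
Proof.
move=> TS WA.
have sT (a b : vec R) : mdot a (T *m b) = mdot (T *m a) b.
  by rewrite mdot_mulmx TS.
have sW (a b : vec R) : mdot a (W *m b) = - mdot (W *m a) b.
  by rewrite mdot_mulmx WA mulNmx mdotNr opprK.
have tT (a b : vec R) :
    mdot (tensor a b) (T + W) = mdot (T *m a) b - mdot (W *m a) b.
  by rewrite mdot_tensor mulmxDl mdotDr sT sW.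
have Wnn : mdot (W *m n) n = 0 by rewrite mdotC mdot_antisym_mul.
have TTW : mdot T (T + W) = mdot T T.
  by rewrite mdotDr (mdot_sym_antisym TS WA) addr0.
have lin (A1 A2 A3 A4 A5 D : ten R) :
    mdot (c1 *: A1 + c2 *: A2 + c3 *: A3 + c4 *: A4 + c5 *: A5) D =
    c1 * mdot A1 D + c2 * mdot A2 D + c3 * mdot A3 D + c4 * mdot A4 D
    + c5 * mdot A5 D by rewrite !mdotDl !mdotZl.
have TWn : mdot (T *m (T *m n)) n - mdot (W *m (T *m n)) n =
    mdot (T *m n) (T *m n) + mdot (W *m n) (T *m n).
  by rewrite -(sT (T *m n) n) (mdotC _ n) sW mdotC opprK.
rewrite lin TTW mdotZl (tT n n) (tT n q) (tT q n) Wnn mdotDl.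
rewrite (tT n (T *m n)) (tT (T *m n) n) TWn.
have -> : mdot (T *m q) n = mdot (T *m n) q by rewrite mdotC sT.
have -> : mdot (W *m q) n = - mdot (W *m n) q by rewrite mdotC sW.
have -> : mdot (T *m n) n = mdot (tensor n n) T by rewrite mdot_tensor sT.
by ring.
Qed.

End VectorAlgebra.

(** The Leslie relation turns [alp2 + alp3] into [gam2], and [alp3 - alp2] is [gam1], so the
    vorticity term gets the coefficient one that its cancellation against the director equation
    requires. *)
Lemma mdot_sigmaL {R : realType} (P : coeffs R) (n q v : vec R)
  (T := strain v) (W := vorticity v) :
  alp2 P + alp3 P = alp6 P - alp5 P -> gam1 P != 0 ->
  mdot (sigmaL P n q T) (grad v) =
  (alp1 P + gam2 P ^+ 2 / gam1 P)%:MP * mdot (tensor n n) T ^+ 2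
  + (alp4 P)%:MP * mdot T T
  + (alp5 P + alp6 P - gam2 P ^+ 2 / gam1 P)%:MP * mdot (T *m n) (T *m n)
  + (gam2 P / gam1 P)%:MP * mdot (T *m n) q + mdot (W *m n) q.
Proof.
move=> Leslie gam1_neq0; rewrite gradE mdot_stress; last 2 first.
- exact: strain_sym.
- exact: vorticity_antisym.
rewrite -!mpolyCD -mpolyCB -mulrDl -mulrBl Leslie -/(gam2 P) -/(gam1 P).
rewrite divff // mpolyC1 mul1r; congr (_ + _ * _ + _ + _); congr _%:MP.
by field.
Qed.

Lemma meval_mdot {R : realType} k l (p q : 'M[{mpoly R[3]}]_(k, l))
  (x : pt3 R) :
  (mdot p q).@[x] = \sum_i \sum_j (p i j).@[x] * (q i j).@[x].
Proof.
rewrite raddf_sum /=; apply: eq_bigr => i _; rewrite raddf_sum /=.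
by apply: eq_bigr => j _; rewrite mevalM.
Qed.

Lemma enormE {R : realType} (u : vec R) (x : pt3 R) :
  enorm (veval u x) = Num.sqrt (mdot u u).@[x].
Proof.
rewrite meval_mdot; congr Num.sqrt; apply: eq_bigr => i _.
by rewrite big_ord1 mxE expr2.
Qed.

(** * Quadrature, LGL nodes, nodal basis and discrete spaces *)

Section Quadrature.
Context {R : realType} {N : nat}.
Variables (B : box R) (Q : lgl_rule R N).
Implicit Types (f g : {mpoly R[3]}) (u v w : vec R).

Lemma quadD f g : quad B Q (f + g) = quad B Q f + quad B Q g.
Proof.
by rewrite /quad -big_split; apply: eq_bigr => j _; rewrite mevalD mulrDr.
Qed.

Lemma quadZ (c : R) f : quad B Q (c%:MP * f) = c * quad B Q f.
Proof.
rewrite /quad mulr_sumr; apply: eq_bigr => j _.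
by rewrite mevalM mevalC mulrCA.
Qed.

Lemma quadN f : quad B Q (- f) = - quad B Q f.
Proof. by rewrite -mulN1r -mpolyC1 -mpolyCN quadZ mulN1r. Qed.

Lemma quadB f g : quad B Q (f - g) = quad B Q f - quad B Q g.
Proof. by rewrite quadD quadN. Qed.

Lemma lgl_node_bounds (j : 'I_N.+1) : -1 <= lgl_node Q j <= 1.
Proof.
have mono (k l : 'I_N.+1) : (k <= l)%N -> lgl_node Q k <= lgl_node Q l.
  rewrite leq_eqVlt => /orP[/eqP/val_inj -> //|/(lgl_node_incr Q)/ltW //].
apply/andP; split.
  by rewrite -(lgl_node_first Q) mono.
by have := mono j ord_max (leq_ord j); rewrite lgl_node_last.
Qed.

Lemma node1_bounds (i : 'I_3) (j : 'I_N.+1) : lo B i <= node1 B Q i j <= hi B i.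
Proof.
have := lo_lt_hi B i; have /andP[] := lgl_node_bounds j; rewrite /node1.
set a := lo _ _; set b := hi _ _; set t := lgl_node _ _ => *.
by apply/andP; split; nra.
Qed.

Lemma node_domain (j : {ffun 'I_3 -> 'I_N.+1}) : domain B (node B Q j).
Proof. by move=> i; exact: node1_bounds. Qed.

Lemma node1_inj (i : 'I_3) : injective (node1 B Q i).
Proof.
move=> j k; have := lo_lt_hi B i; rewrite /node1.
set a := lo _ _; set b := hi _ _ => ab e.
have e' : lgl_node Q j = lgl_node Q k.
  have : (b - a) * (lgl_node Q j - lgl_node Q k) = 0 by lra.
  by move=> /eqP; rewrite mulf_eq0 !subr_eq0 gt_eqF //= => /eqP.
have [/(lgl_node_incr Q)|/(lgl_node_incr Q)|/val_inj //] := ltngtP j k.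
  by rewrite e' ltxx.
by rewrite e' ltxx.
Qed.

Lemma meval_along (i : 'I_3) (p : {poly R}) (x : pt3 R) :
  (along i p).@[x] = p.[x i].
Proof.
rewrite /along -horner_map /= mevalXU -map_poly_comp map_poly_id // => c _.
by rewrite /= mevalC.
Qed.

Lemma lagrange1_node (i : 'I_3) (j k : 'I_N.+1) :
  (lagrange1 B Q i j).[node1 B Q i k] = (j == k)%:R.
Proof.
rewrite horner_prod; have [<-|jk] := eqVneq.
  apply: big1 => l lj; rewrite hornerZ hornerXsubC mulVf // subr_eq0.
  by rewrite (inj_eq (@node1_inj i)) eq_sym.
apply/eqP/prodf_eq0; exists k; first by rewrite eq_sym.
by rewrite hornerZ hornerXsubC subrr mulr0.
Qed.

Lemma nodal_basis_node (j k : {ffun 'I_3 -> 'I_N.+1}) :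
  (nodal_basis B Q j).@[node B Q k] = (j == k)%:R.
Proof.
rewrite rmorph_prod /=; under eq_bigr do rewrite meval_along lagrange1_node.
have [<-|jk] := eqVneq; first by rewrite big1 // => i _; rewrite eqxx.
apply/eqP/prodf_eq0; have /existsP[i ji] : [exists i, j i != k i].
  rewrite -negb_forall; apply: contra jk => /forallP e.
  by apply/eqP/ffunP => i; apply/eqP.
by exists i; rewrite // (negPf ji).
Qed.

(** Basis and quadrature share their nodes, so testing with a nodal basis function turns a discrete
    integral identity into a pointwise one. *)
Lemma quad_nodal f j :
  quad B Q (nodal_basis B Q j * f) = weight B Q j * f.@[node B Q j].
Proof.
rewrite /quad (bigD1 j) //= mevalM nodal_basis_node eqxx mul1r big1 ?addr0 //.
by move=> k kj; rewrite mevalM nodal_basis_node eq_sym (negPf kj) mul0r mulr0.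
Qed.

Lemma size_lagrange1 (i : 'I_3) (j : 'I_N.+1) :
  (size (lagrange1 B Q i j) <= N.+1)%N.
Proof.
rewrite /lagrange1 scaler_prod (leq_trans (size_scale_leq _ _)) //.
rewrite size_prod; last by move=> k _; rewrite polyXsubC_eq0.
under eq_bigr do rewrite size_XsubC.
by rewrite sum_nat_const cardC1 card_ord; lia.
Qed.

Lemma nodal_basis_XN j : XN (N := N) (nodal_basis B Q j).
Proof.
pose a i k := (lagrange1 B Q i (j i))`_k.
have -> : nodal_basis B Q j = \sum_(h : {ffun 'I_3 -> 'I_N.+1})
    (\prod_i a i (h i)) *: 'X_[[multinom (h i : nat) | i < 3]].
  rewrite /nodal_basis; under eq_bigr => i _.
    (* All factors are padded to N + 1 coefficients: distributing the product over the sums needs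
       one common index type, and its values then bound the exponents. *)
    rewrite /along (@horner_coef_wide _ N.+1); last first.
      by rewrite (leq_trans (size_poly _ _)) // size_lagrange1.
    over.
  rewrite bigA_distr_bigA; apply: eq_bigr => h _.
  rewrite mpolyXE_id -mul_mpolyC rmorph_prod -big_split /=.
  by apply: eq_bigr => i _; rewrite coef_map mnmE.
move=> m; rewrite mcoeff_msupp raddf_sum /= => m0 i.
have [h ->] : exists h : {ffun 'I_3 -> 'I_N.+1},
    m = [multinom (h i : nat) | i < 3].
  apply: contrapT => nh; move: m0; rewrite big1 ?eqxx // => h _.
  rewrite mcoeffZ mcoeffX (_ : (_ == m) = false) ?mulr0 //.
  by apply/negP => /eqP e; apply: nh; exists h.
by rewrite mnmE leq_ord.
Qed.

Definition inner_index (j : {ffun 'I_3 -> 'I_N.+1}) : Prop :=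
  forall i, j i != ord0 /\ j i != ord_max.

Lemma node1_first (i : 'I_3) : node1 B Q i ord0 = lo B i.
Proof. by rewrite /node1 (lgl_node_first Q); field. Qed.

Lemma node1_last (i : 'I_3) : node1 B Q i ord_max = hi B i.
Proof. by rewrite /node1 (lgl_node_last Q); field. Qed.

(** On a whole face the fixed coordinate is an end node other than the one indexed by [j i], so the
    i-th Lagrange factor vanishes there. *)
Lemma nodal_basis_XN0 j : inner_index j -> XN0 (N := N) B (nodal_basis B Q j).
Proof.
move=> jI; split; first exact: nodal_basis_XN.
move=> x [_ [i xi]]; have [j0 jmax] := jI i.
rewrite rmorph_prod /=; apply/eqP/prodf_eq0; exists i => //.
rewrite meval_along; case: xi => ->.
  by rewrite -node1_first lagrange1_node (negPf j0).
by rewrite -node1_last lagrange1_node (negPf jmax).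
Qed.

Lemma bgrid_node j : ~ inner_index j -> bgrid B Q (node B Q j).
Proof.
move=> /existsNP[i jI]; split; first by exists j.
split; first exact: node_domain.
exists i; apply: contrapT => nb; apply: jI.
split; apply: contra_notN nb => /eqP ji; rewrite /node ji.
  by left; exact: node1_first.
by right; exact: node1_last.
Qed.

Lemma XN_scale (c : R) f : XN (N := N) f -> XN (N := N) (c%:MP * f).
Proof.
by move=> Xf m; rewrite mul_mpolyC => /msuppZ_le; exact: Xf.
Qed.

(** The factor is a constant vector, meant to be a nodal value: multiplying the basis function by
    the director field itself could raise the degree beyond N. *)
Lemma DN0_nodal j (c : 'cV[R]_3) : inner_index j ->
  DN0 N B (nodal_basis B Q j *: map_mx (@mpolyC 3 R) c).
Proof.
move=> jI i; rewrite !mxE mulrC; have [Xf f0] := nodal_basis_XN0 jI.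
by split=> [|x bx]; [exact: XN_scale | rewrite mevalM f0 // mulr0].
Qed.

Lemma XN0B f g : XN0 (N := N) B f -> XN0 (N := N) B g -> XN0 (N := N) B (f - g).
Proof.
move=> [Xf f0] [Xg g0]; split=> [m /msuppB_le|x bx].
  by rewrite mem_cat => /orP[/Xf|/Xg].
by rewrite mevalB f0 // g0 // subrr.
Qed.

(** The common lift of the data drops out. With data independent of time this makes the director
    increment an admissible test function. *)
Lemma DNg_sub (g : pt3 R -> 'cV[R]_3) u v : DNg B Q g u -> DNg B Q g v ->
  DN0 N B (u - v).
Proof.
move=> [u' Du <-] [v' Dv <-] i; rewrite !mxE.
by rewrite opprD addrACA subrr add0r; exact: XN0B.
Qed.

Lemma DNg_boundary (g : pt3 R -> 'cV[R]_3) u x : DNg B Q g u -> boundary B x ->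
  veval u x = veval (interp B Q g) x.
Proof.
move=> [w Dw <-] bx; apply/colP => i; rewrite !mxE mevalD.
by have [_ ->] := Dw i; rewrite ?addr0 // !mxE.
Qed.

Lemma interp_eq0 (g : pt3 R -> 'cV[R]_3) : (forall x, domain B x -> g x = 0) ->
  interp B Q g = 0.
Proof.
move=> g0; apply/colP => i; rewrite !mxE big1 // => j _.
by rewrite g0 ?mxE ?scale0r //; exact: node_domain.
Qed.

(** Linearity of the span and of the Piola map; together with [VN0Z] it allows testing with the
    midpoint velocity. *)
Lemma VN0D u v : VN0 N B u -> VN0 N B v -> VN0 N B (u + v).
Proof.
move=> [u' [c cE] <-] [v' [d dE] <-]; exists (u' + v').
  exists (fun k m n l => c k m n l + d k m n l); rewrite cE dE -big_split.
  do 4![apply: eq_bigr => ? _; rewrite -?big_split /=].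
  by rewrite mpolyCD scalerDl.
rewrite /piola (_ : map_mx _ (u' + v') =
    map_mx (comp_mpoly (inv_affine B)) u'
    + map_mx (comp_mpoly (inv_affine B)) v').
  by rewrite mulmxDr.
by apply/matrixP => i j; rewrite !mxE comp_mpolyD.
Qed.

Lemma VN0Z (a : R) u : VN0 N B u -> VN0 N B (a%:MP *: u).
Proof.
move=> [u' [c cE] <-]; exists (a%:MP *: u').
  exists (fun k m n l => a * c k m n l); rewrite cE.
  do 4![rewrite scaler_sumr; apply: eq_bigr => ? _].
  by rewrite scalerA -mpolyCM.
rewrite /piola (_ : map_mx _ (a%:MP *: u') =
  a%:MP *: map_mx (comp_mpoly (inv_affine B)) u').
  by rewrite scalemxAr.
by apply/matrixP => i j; rewrite !mxE rmorphM /= comp_mpolyC.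
Qed.

End Quadrature.

(** * Positivity of the discrete inner product *)

Section Positivity.
Context {R : realType} {N : nat}.
Variables (B : box R) (Q : lgl_rule R N).
Hypothesis N_gt0 : (0 < N)%N.

Lemma weight_gt0 (j : {ffun 'I_3 -> 'I_N.+1}) : 0 < weight B Q j.
Proof.
apply: prodr_gt0 => i _; rewrite mulr_gt0 ?lgl_weight_gt0 //.
by rewrite divr_gt0 // subr_gt0 lo_lt_hi.
Qed.

Lemma quad_ge0 (f : {mpoly R[3]}) : (forall x, 0 <= f.@[x]) -> 0 <= quad B Q f.
Proof.
by move=> f0; apply: sumr_ge0 => j _; rewrite mulr_ge0 // ltW ?weight_gt0.
Qed.

Lemma dip_ge0 k l (p : 'M[{mpoly R[3]}]_(k, l)) : 0 <= dip B Q p p.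
Proof.
apply: quad_ge0 => x; rewrite meval_mdot.
by do 2!(apply: sumr_ge0 => ? _); rewrite -expr2 sqr_ge0.
Qed.

Lemma sdip_ge0 (f : {mpoly R[3]}) : 0 <= sdip B Q f f.
Proof. by apply: quad_ge0 => x; rewrite mevalM -expr2 sqr_ge0. Qed.

(** [Num.sqrt] is zero on negative arguments, so recovering the quadratic form relies on its
    nonnegativity. *)
Lemma dnorm_sqr k l (p : 'M[{mpoly R[3]}]_(k, l)) :
  dnorm B Q p ^+ 2 = dip B Q p p.
Proof. by rewrite sqr_sqrtr // dip_ge0. Qed.

Lemma sdnorm_sqr (f : {mpoly R[3]}) : sdnorm B Q f ^+ 2 = sdip B Q f f.
Proof. by rewrite sqr_sqrtr // sdip_ge0. Qed.

End Positivity.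

(** * Discrete product rules at the midpoint *)

Section Midpoint.
Context {R : realType}.
Implicit Types (u v w : vec R).
Local Notation half := ((2^-1)%:MP : {mpoly R[3]}).

Lemma mdot_mid u v : mdot (u - v) (half *: (u + v)) =
  half * (mdot u u - mdot v v).
Proof.
rewrite mdotZr mdotDl !mdotDr !mdotNl (mdotC v u); congr (_ * _).
by ring.
Qed.

Lemma curl_linear (c : R) u v :
  curl (c%:MP *: u + v) = c%:MP *: curl u + curl v.
Proof.
apply/colP => i; rewrite !mxE !mul_mpolyC !mderivD !mderivZ -!mul_mpolyC.
by ring.
Qed.

Lemma dvg_linear (c : R) u v : dvg (c%:MP *: u + v) = c%:MP * dvg u + dvg v.
Proof.
rewrite /dvg mulr_sumr -big_split; apply: eq_bigr => i _.
by rewrite !mxE !mul_mpolyC mderivD mderivZ.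
Qed.

Lemma curlB u v : curl (u - v) = curl u - curl v.
Proof.
by rewrite addrC -scaleN1r -mpolyC1 -mpolyCN curl_linear mpolyCN scaleN1r addrC.
Qed.

Lemma dvgB u v : dvg (u - v) = dvg u - dvg v.
Proof.
by rewrite addrC -scaleN1r -mpolyC1 -mpolyCN dvg_linear mpolyCN mulN1r addrC.
Qed.

Lemma curl0 : curl (0 : vec R) = 0.
Proof. by have := curlB 0 0; rewrite !subrr. Qed.

Lemma dvg0 : dvg (0 : vec R) = 0.
Proof. by have := dvgB 0 0; rewrite !subrr. Qed.

Lemma curl_mid u v : curl (half *: (u + v)) = half *: (curl u + curl v).
Proof.
rewrite scalerDr curl_linear -[half *: v]addr0 curl_linear curl0 addr0.
by rewrite scalerDr.
Qed.

Lemma dvg_mid u v : dvg (half *: (u + v)) = half * (dvg u + dvg v).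
Proof.
by rewrite scalerDr dvg_linear -[half *: v]addr0 dvg_linear dvg0 addr0 mulrDr.
Qed.

(** The discrete product rule. With each [v] the curl of the matching [u], the right-hand side is
    the increment of [betaF]. *)
Lemma mdot_increment u1 u0 v1 v0 :
  mdot (half *: (v1 + v0)) (u1 - u0) + mdot (half *: (u1 + u0)) (v1 - v0) =
  mdot u1 v1 - mdot u0 v0.
Proof.
rewrite -[RHS]mul1r -mpoly_halfD !mdotZl !mdotDl !mdotDr !mdotNr.
by rewrite (mdotC v1 u1) (mdotC v1 u0) (mdotC v0 u1) (mdotC v0 u0); ring.
Qed.

(** The product rule for [cross], by cyclicity of the triple product; with curls for [v1] and [v0]
    it yields the increment of [omegaF] tested against [w]. *)
Lemma cross_increment w u1 u0 v1 v0 :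
  mdot (cross (half *: (v1 + v0)) w) (u1 - u0)
  + mdot (cross w (half *: (u1 + u0))) (v1 - v0) =
  mdot w (cross u1 v1 - cross u0 v0).
Proof.
(* Writing 1 as a sum of two halves makes both sides linear in the constant, which [ring] can then
   treat as an unknown. *)
rewrite -[RHS]mul1r -mpoly_halfD !mdotE !mxE !I3D.
by move: half => h; ring.
Qed.

Lemma meval_mdot_cst (a : vec R) (b : vec R) (x : pt3 R) :
  (mdot a (map_mx (@mpolyC 3 R) (veval b x))).@[x] = (mdot a b).@[x].
Proof. by rewrite !meval_mdot !sum3E !big_ord1 !mxE !mevalC. Qed.

End Midpoint.

(** * The discrete forms of the scheme at their test functions *)

Section DiscreteForms.
Context {R : realType} {N : nat}.
Variables (B : box R) (Q : lgl_rule R N).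

Lemma triN_self (u w : vec R) : triN B Q u w w = 0.
Proof. by rewrite /triN subrr mulr0. Qed.

Lemma dip_convect (u v w : vec R) :
  dip B Q (grad v *m w) u = dip B Q (convect u v) w.
Proof. by rewrite /dip mdot_convect. Qed.

Lemma dipDl (u v w : vec R) : dip B Q (u + v) w = dip B Q u w + dip B Q v w.
Proof. by rewrite /dip mdotDl quadD. Qed.

Lemma dip_sigmaL (P : coeffs R) (n q v : vec R) (T := strain v) :
  alp2 P + alp3 P = alp6 P - alp5 P -> gam1 P != 0 ->
  dip B Q (sigmaL P n q T) (grad v) =
  (alp1 P + gam2 P ^+ 2 / gam1 P) * quad B Q (mdot (tensor n n) T ^+ 2)
  + alp4 P * dip B Q T T
  + (alp5 P + alp6 P - gam2 P ^+ 2 / gam1 P) * dip B Q (T *m n) (T *m n)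
  + gam2 P / gam1 P * dip B Q (T *m n) q + dip B Q (vorticity v *m n) q.
Proof. by move=> ? ?; rewrite {1}/dip mdot_sigmaL // !quadD !quadZ. Qed.

Lemma dip_mid (u w : vec R) : dip B Q (u - w) ((2^-1)%:MP *: (u + w)) =
  2^-1 * (dip B Q u u - dip B Q w w).
Proof. by rewrite /dip mdot_mid quadZ quadB. Qed.

End DiscreteForms.

(** * Consequences of the tested equations *)

Section Conservation.
Context {R : realType} {N : nat}.
Variables (B : box R) (Q : lgl_rule R N) (P : coeffs R).
Hypothesis N_gt0 : (0 < N)%N.
Variables (g1 g2 : nat -> pt3 R -> 'cV[R]_3) (dt : nat -> R).
Variables (v n mu : nat -> vec R).
Hypothesis sol : is_solution B Q P g1 g2 dt v n mu.

Lemma inner_node_length m j : inner_index j ->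
  (mdot (n m.+1) (n m.+1)).@[node B Q j] = (mdot (n m) (n m)).@[node B Q j].
Proof.
move=> jI; have w_neq0 : weight B Q j != 0 by rewrite gt_eqF ?weight_gt0.
have := director sol m (DN0_nodal B Q (veval (mid n m) (node B Q j)) jI).
rewrite /director_eq /dip !mdotZr !quad_nodal !meval_mdot_cst mdot_cross_id.
rewrite meval0 !mulr0 mdot_mid mevalM mevalC mevalB => /eqP.
by rewrite !mulf_eq0 (negPf w_neq0) invr_eq0 pnatr_eq0 /= subr_eq0 => /eqP.
Qed.

Lemma energyNE u : energyN B Q P u =
  2^-1 * (kap1 P * sdip B Q (dvg u) (dvg u)
        + kap2 P * sdip B Q (betaF u) (betaF u)
        + kap3 P * dip B Q (omegaF u) (omegaF u)).
Proof.
rewrite /energyN (dnorm_sqr _ _ N_gt0 (omegaF u)).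
by rewrite (sdnorm_sqr _ _ N_gt0 (dvg u)) (sdnorm_sqr _ _ N_gt0 (betaF u)).
Qed.

(** The divergence term is handled by linearity. For [kap2] and [kap3] a product rule merges the two
    terms with the same constant; the averaged [betaF] or [omegaF] then meets its own increment,
    which gives half a difference of squares. *)
Lemma energy_increment m :
  potential_eq B Q P n mu m (n m.+1 - n m) ->
  - dip B Q (n m.+1 - n m) (mu m) =
  energyN B Q P (n m.+1) - energyN B Q P (n m).
Proof.
rewrite /potential_eq /smid /mid /= /dip /sdip mdotNl quadN mdotC => ->.
set h := (2^-1)%:MP; set u1 := n m.+1; set u0 := n m.
have E1 : quad B Q (dvg (h *: (u1 + u0)) * dvg (u1 - u0)) =
    2^-1 * (sdip B Q (dvg u1) (dvg u1) - sdip B Q (dvg u0) (dvg u0)).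
  rewrite dvg_mid dvgB /sdip -quadB -quadZ; congr quad.
  by rewrite -/h; ring.
have E2 :
    quad B Q (mdot ((2^-1 *: (betaF u1 + betaF u0)) *: curl (h *: (u1 + u0)))
                   (u1 - u0))
    + quad B Q (mdot ((2^-1 *: (betaF u1 + betaF u0)) *: (h *: (u1 + u0)))
                     (curl (u1 - u0))) =
    2^-1 * (sdip B Q (betaF u1) (betaF u1) - sdip B Q (betaF u0) (betaF u0)).
  rewrite -quadD (mdotZl (2^-1 *: _)) (mdotZl (2^-1 *: _)) -mulrDr.
  rewrite curl_mid curlB mdot_increment -mul_mpolyC /sdip -quadB -quadZ.
  by congr quad; rewrite -/(betaF u1) -/(betaF u0); ring.
have E3 : quad B Q (mdot (cross (curl (h *: (u1 + u0)))
                                (h *: (omegaF u1 + omegaF u0))) (u1 - u0))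
    + quad B Q (mdot (cross (h *: (omegaF u1 + omegaF u0)) (h *: (u1 + u0)))
                     (curl (u1 - u0))) =
    2^-1 * (dip B Q (omegaF u1) (omegaF u1) - dip B Q (omegaF u0) (omegaF u0)).
  by rewrite -quadD curl_mid curlB cross_increment mdotC -dip_mid.
rewrite E1 -!addrA (addrA (kap2 P * _)) -!mulrDr E2 E3 !energyNE.
move: (sdip _ _ (dvg u1) _) (sdip _ _ (dvg u0) _) (sdip _ _ (betaF u1) _)
  (sdip _ _ (betaF u0) _) (dip _ _ (omegaF u1) _) (dip _ _ (omegaF u0) _).
by move=> *; ring.
Qed.

(** Symmetry moves the double cross product from the bracket to [mu m], so the velocity terms are
    paired with q as in the momentum equation, and the term in [mu m] becomes a square, the director
    dissipation. *)
Lemma director_mu m : DN0 N B (mu m) ->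
  dip B Q (n m.+1 - n m) (mu m) =
  dt m / gam1 P *
  (dip B Q (cross (mid n m) (mu m)) (cross (mid n m) (mu m))
   - gam1 P * dip B Q (convect (mid v m) (mid n m)
                       + vorticity (mid v m) *m mid n m)
                      (cross (cross (mid n m) (mu m)) (mid n m))
   - gam2 P * dip B Q (strain (mid v m) *m mid n m)
                      (cross (cross (mid n m) (mu m)) (mid n m))).
Proof.
move=> /(director sol m) ->; congr (_ * _).
set nh := mid n m; set q := cross (cross nh (mu m)) nh.
rewrite /dip mdot_cross_cross mdotC -mdot_cross_cross mdotC -/q.
rewrite !mdotDl !mdotNl !mdotZl !quadB !quadZ quadD; congr (_ - _ - _).
  by rewrite /q mdotC mdot_cross_cross.
by rewrite mdotDl quadD.
Qed.

Lemma velocity_VN0 m : (forall x, domain B x -> g1 m x = 0) -> VN0 N B (v m).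
Proof.
move=> g10; have [w Vw <-] := velocity_space sol m.
by rewrite interp_eq0 ?add0r.
Qed.

End Conservation.

(* A, W and T are the products of q with v . grad n, Omega . n and tau . n; they
   enter both equations and cancel. *)
Lemma energy_balance (R : realFieldType)
  (Re g g1 g2 c1 c2 c3 dt V1 V0 F1 F0 G S1 S2 S3 X A W T : R) :
  0 < Re -> 0 < g < 1 -> 0 < g1 -> 0 < dt -> 0 <= c1 -> 0 <= c2 -> 0 <= c3 ->
  0 <= G -> 0 <= S1 -> 0 <= S2 -> 0 <= S3 -> 0 <= X ->
  dt^-1 * (2^-1 * (V1 - V0)) = - 0 - g / Re * G
    - (1 - g) / Re * (c1 * S1 + c2 * S2 + c3 * S3 + g2 / g1 * T + W)
    - (1 - g) / Re * A ->
  - (dt / g1 * (X - g1 * (A + W) - g2 * T)) = F1 - F0 ->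
  Re / (2 * (1 - g)) * V1 + F1 <= Re / (2 * (1 - g)) * V0 + F0.
Proof.
move=> Re0 /andP[g0 g_lt1] g10 dt0 c10 c20 c30 G0 S10 S20 S30 X0 mom pot.
have g'0 : 0 < 1 - g by rewrite subr_gt0.
(* Both new energies are written as old ones plus increments given by the tested equations, which
   reduces the claim to the sign of the dissipation. *)
have -> : V1 = V0 + 2 * dt * (dt^-1 * (2^-1 * (V1 - V0))).
  by field; rewrite gt_eqF.
have -> : F1 = F0 - dt / g1 * (X - g1 * (A + W) - g2 * T).
  by rewrite pot addrC subrK.
rewrite mom -subr_ge0.
(* The weight of the kinetic energy gives [A], [W] and [T] opposite coefficients in the two
   increments. Viscous, Leslie and director dissipation remain. *)
have -> : Re / (2 * (1 - g)) * V0 + F0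
    - (Re / (2 * (1 - g)) * (V0 + 2 * dt * (- 0 - g / Re * G
      - (1 - g) / Re * (c1 * S1 + c2 * S2 + c3 * S3 + g2 / g1 * T + W)
      - (1 - g) / Re * A))
    + (F0 - dt / g1 * (X - g1 * (A + W) - g2 * T))) =
  dt * (g / (1 - g) * G + c1 * S1 + c2 * S2 + c3 * S3 + X / g1).
  by field; rewrite !gt_eqF.
by rewrite mulr_ge0 ?addr_ge0 ?mulr_ge0 ?invr_ge0 // ltW // divr_gt0.
Qed.

Theorem theorem1 (R : realType) (N : nat) (B : box R) (Q : lgl_rule R N)
  (P : coeffs R)
  (g1 : nat -> pt3 R -> 'cV[R]_3) (g2 : pt3 R -> 'cV[R]_3)
  (dt : nat -> R) (v n mu : nat -> vec R)
  (N_gt0 : (0 < N)%N)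
  (Rey_gt0 : 0 < Rey P)
  (Leslie : alp2 P + alp3 P = alp6 P - alp5 P)
  (gam_in01 : 0 < gam P < 1)
  (gam1_gt0 : 0 < gam1 P)
  (alp4_ge0 : 0 <= alp4 P)
  (alp1_cond : 0 <= alp1 P + gam2 P ^+ 2 / gam1 P)
  (alp56_cond : 0 <= alp5 P + alp6 P - gam2 P ^+ 2 / gam1 P)
  (dt_gt0 : forall m, 0 < dt m)
  (n_nodal : forall m, in_nodal_span B Q (n m))
  (n0_unit : forall x, grid B Q x -> enorm (veval (n 0%N) x) = 1)
  (g2_unit : forall x, bgrid B Q x -> enorm (veval (interp B Q g2) x) = 1)
  (sol : is_solution B Q P g1 (fun=> g2) dt v n mu) :
  (forall m x, grid B Q x -> enorm (veval (n m) x) = 1) /\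
  ((forall m x, domain B x -> g1 m x = 0) ->
   forall m,
     Rey P / (2 * (1 - gam P)) * dnorm B Q (v m.+1) ^+ 2
       + energyN B Q P (n m.+1)
     <= Rey P / (2 * (1 - gam P)) * dnorm B Q (v m) ^+ 2
       + energyN B Q P (n m)).
Proof.
split.
  elim=> [//|m IHm] x gx; have [j _ xE] := gx; rewrite -{x}xE in gx *.
  have [jI|/(bgrid_node B Q) bx] := pselect (inner_index j).
    by rewrite enormE (inner_node_length N_gt0 sol) // -enormE IHm.
  have [_ b] := bx.
  by rewrite (DNg_boundary (director_space sol m.+1)) // g2_unit.
move=> g10 m.
(* With zero boundary data the affine velocity space is linear, so the midpoint velocity is itself a
   test function. *)
have Vv k : VN0 N B (v k) by apply: (velocity_VN0 sol) (g10 k).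
have gam1_neq0 : gam1 P != 0 by rewrite gt_eqF.
have mom := momentum sol m (VN0Z (2^-1) (VN0D (Vv m.+1) (Vv m))).
have := energy_increment N_gt0 (potential sol m
  (DNg_sub (director_space sol m.+1) (director_space sol m))).
rewrite (director_mu sol (potential_space sol m)) dipDl => pot.
move: mom; rewrite /momentum_eq dip_mid -/(mid v m).
rewrite (triN_self B Q (mid v m)).
rewrite (dip_sigmaL B Q _ _ _ Leslie gam1_neq0).
rewrite (dip_convect B Q (mid v m) (mid n m)) => mom.
rewrite (dnorm_sqr _ _ N_gt0 (v m)) (dnorm_sqr _ _ N_gt0 (v m.+1)).
(* The goals left are the signs of the viscous term, of the three stress terms and of the director
   dissipation, in this order. *)
apply: (energy_balance Rey_gt0 gam_in01 gam1_gt0 (dt_gt0 m)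
          alp1_cond alp4_ge0 alp56_cond _ _ _ _ _ mom pot).
- exact: dip_ge0.
- by apply: quad_ge0 => // x; rewrite rmorphXn sqr_ge0.
- exact: dip_ge0.
- exact: dip_ge0.
- exact: dip_ge0.
Qed.
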